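(* Let $R$ be a commutative ring with a derivation $D_R$. Let $A$ be a differential Azumaya $R$-algebra, and let $P$ be an $A$-module which is finitely generated and projective as an $R$-module. Then there is a differential structure on $P$ making $P$ a differential $A$-module.
   Context: A differential Azumaya $R$-algebra is an Azumaya $R$-algebra $A$ with a derivation $D_A$ extending $D_R$. A (left) $A$-module $P$ is a differential $A$-module if it is equipped with an additive endomorphism $D_P$ (a differential structure) satisfying $D_P(ap)=D_A(a)p+aD_P(p)$ for all $a\in A$, $p\in P$. *)

(* Defs.v *)
From HB Require Import structures.
From mathcomp Require Import all_boot all_algebra.
Set Implicit Arguments.
Unset Strict Implicit.
Unset Printing Implicit Defensive.
Import GRing.Theory.
Local Open Scope ring_scope.

Definition finitely_generated (R : pzRingType) (M : lmodType R) : Prop :=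
  exists (n : nat) (e : 'I_n -> M),
    forall x : M, exists c : 'I_n -> R, x = \sum_(i < n) c i *: e i.

Definition projective (R : pzRingType) (P : lmodType R) : Prop :=
  forall (M N : lmodType R) (g : {linear M -> N}) (f : {linear P -> N}),
    (forall y : N, exists x : M, g x = y) ->
    exists h : {linear P -> M}, forall p : P, g (h p) = f p.

Definition faithful (R : pzRingType) (M : lmodType R) : Prop :=
  forall r : R, (forall x : M, r *: x = 0) -> r = 0.

(* A finite formal sum of pure tensors x (x) y is a list of pairs (x, y), with
   concatenation as addition; the quotient of these lists by [tensor_eq] is the
   tensor product of M and N over R (the opposite of a class is obtained by
   negating the first components). *)
Inductive tensor_eq (R : comPzRingType) (M N : lmodType R) :
    seq (M * N) -> seq (M * N) -> Prop :=
| tensor_refl s : tensor_eq s s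
| tensor_sym s t : tensor_eq s t -> tensor_eq t s
| tensor_trans s t u : tensor_eq s t -> tensor_eq t u -> tensor_eq s u
| tensor_cat s s' t t' :
    tensor_eq s s' -> tensor_eq t t' -> tensor_eq (s ++ t) (s' ++ t')
| tensor_catC s t : tensor_eq (s ++ t) (t ++ s)
| tensor_0l y : tensor_eq [:: (0, y)] [::]
| tensor_Dl x x' y : tensor_eq [:: (x + x', y)] [:: (x, y); (x', y)]
| tensor_Dr x y y' : tensor_eq [:: (x, y + y')] [:: (x, y); (x, y')]
| tensor_Z (r : R) x y : tensor_eq [:: (r *: x, y)] [:: (x, r *: y)].

(* The canonical map from A (x) A^op to End_R(A), a (x) b |-> (x |-> a x b). *)
Definition enveloping_action (R : comPzRingType) (A : algType R)
    (s : seq (A * A)) (x : A) : A :=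
  \sum_(ab <- s) ab.1 * x * ab.2.

Lemma enveloping_action_linear (R : comPzRingType) (A : algType R)
    (s : seq (A * A)) : linear (enveloping_action s).
Proof.
move=> r x y; rewrite /enveloping_action scaler_sumr -big_split /=.
by apply: eq_bigr => ab _; rewrite mulrDr mulrDl -scalerAr -scalerAl.
Qed.

Lemma enveloping_action_tensor_eq (R : comPzRingType) (A : algType R)
    (s t : seq (A * A)) :
  tensor_eq s t -> enveloping_action s =1 enveloping_action t.
Proof.
rewrite /enveloping_action; elim=> {s t}.
- by [].
- by move=> s t _ IH x; rewrite IH.
- by move=> s t u _ IH1 _ IH2 x; rewrite IH1.
- by move=> s s' t t' _ IH1 _ IH2 x; rewrite !big_cat /= IH1 IH2.
- by move=> s t x; rewrite !big_cat /= addrC.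
- by move=> b x; rewrite big_seq1 big_nil !mul0r.
- by move=> a a' b x; rewrite !big_cons !big_nil !addr0 /= !mulrDl.
- by move=> a b b' x; rewrite !big_cons !big_nil !addr0 /= !mulrDr.
- by move=> r a b x; rewrite !big_seq1 /= -!scalerAl -scalerAr.
Qed.

(* The last two clauses say that A (x) A^op -> End_R(A) is injective and
   surjective. *)
Definition azumaya (R : comPzRingType) (A : algType R) : Prop :=
  [/\ finitely_generated (A : lmodType R),
      projective (A : lmodType R),
      faithful (A : lmodType R),
      forall s t : seq (A * A),
        enveloping_action s =1 enveloping_action t -> tensor_eq s t
    & forall f : {linear A -> A},
        exists s : seq (A * A), enveloping_action s =1 f].

Definition is_derivation (S : pzRingType) (D : S -> S) : Prop :=
  (forall a b : S, D (a + b) = D a + D b) /\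
  (forall a b : S, D (a * b) = D a * b + a * D b).

Definition extends_derivation (R : comPzRingType) (A : algType R)
    (D_R : R -> R) (D_A : A -> A) : Prop :=
  forall r : R, D_A r%:A = (D_R r)%:A.

Definition is_differential_structure (S : pzRingType) (D : S -> S)
    (P : lmodType S) (D_P : P -> P) : Prop :=
  (forall p q : P, D_P (p + q) = D_P p + D_P q) /\
  (forall (a : S) (p : P), D_P (a *: p) = D a *: p + a *: D_P p).

Definition restrict_scalars (R : comPzRingType) (A : algType R)
  (P : lmodType A) : Type := P.

Section RestrictScalars.
Variables (R : comPzRingType) (A : algType R) (P : lmodType A).

HB.instance Definition _ := GRing.Zmodule.on (restrict_scalars P).

Definition restrict_scale (r : R) (p : restrict_scalars P) :
  restrict_scalars P := (r%:A : A) *: (p : P).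

Fact restrict_scaleA (r s : R) (p : restrict_scalars P) :
  restrict_scale r (restrict_scale s p) = restrict_scale (r * s) p.
Proof. by rewrite /restrict_scale scalerA -scalerAl mul1r scalerA. Qed.

Fact restrict_scale1 : left_id 1 restrict_scale.
Proof. by move=> p; rewrite /restrict_scale !scale1r. Qed.

Fact restrict_scaleDr : right_distributive restrict_scale +%R.
Proof. by move=> r p q; rewrite /restrict_scale scalerDr. Qed.

Fact restrict_scaleDl (p : restrict_scalars P) :
  {morph restrict_scale^~ p : r s / r + s}.
Proof. by move=> r s; rewrite /restrict_scale !scalerDl. Qed.

HB.instance Definition _ :=
  GRing.Zmodule_isLmodule.Build R (restrict_scalars P)
    restrict_scaleA restrict_scale1 restrict_scaleDr restrict_scaleDl.
End RestrictScalars.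

Lemma restrict_scaleE (R : comPzRingType) (A : algType R) (P : lmodType A)
    (r : R) (p : P) :
  r *: (p : restrict_scalars P) = (r%:A : A) *: p :> P.
Proof. by []. Qed.

(* Main.v *)
(** As [P] is finitely generated projective over [R], the derivation [D_R] lifts
    along a dual basis to an additive [D0] on [P] with
    [D0 (r p) = D_R r p + r D0 p].  Its defect
    [phi a p = D0 (a p) - D_A a p - a D0 p] is an R-linear derivation of [A]
    into [End_R P], and it is inner because [A] is separable: if
    [sum a_i (x) b_i] is a separability element, then [phi a = u a - a u] for
    [u = sum phi(a_i) b_i], so that [D0 - u] is a differential structure.

    The separability element is the preimage in [A (x) A^op] of an endomorphism
    [x |-> t(x) 1] of [A] with [t : A -> R] linear and [t(1) = 1].  Such a [t]
    exists because the ideal [I] of the values at [1] of linear forms satisfies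
    [A = I A] by the dual basis property; by Nakayama's lemma some element of
    [1 + I] kills the faithful module [A], hence [1] lies in [I]. *)
Require Import Defs.
From HB Require Import structures.
From mathcomp Require Import all_boot all_algebra.
Set Implicit Arguments.
Unset Strict Implicit.
Unset Printing Implicit Defensive.
Import GRing.Theory.
Local Open Scope ring_scope.

(** Projectivity splits the surjection from ['rV[R]_n] given by the generators; the forms [f i] are
    the coordinates of the section. *)
Lemma dual_basis (R : comPzRingType) (M : lmodType R) :
  finitely_generated M -> projective M ->
  exists (n : nat) (e : 'I_n -> M) (f : 'I_n -> M -> R),
    (forall i (r : R) x y, f i (r *: x + y) = r * f i x + f i y) /\
    (forall x, x = \sum_(i < n) f i x *: e i).
Proof.
move=> [n [e gen]] proj.
pose g (v : 'rV[R]_n) : M := \sum_(i < n) v 0 i *: e i.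
have g_lin : linear g.
  move=> r u v; rewrite /g scaler_sumr -big_split /=.
  by apply: eq_bigr => i _; rewrite !mxE scalerDl scalerA.
pose gL := GRing.isLinear.Build _ _ _ _ g g_lin.
pose G : {linear 'rV[R]_n -> M} := HB.pack g gL.
have [|h hK] := proj _ _ G (idfun : {linear M -> M}).
  move=> y; have [c ->] := gen y; exists (\row_i c i).
  by rewrite /= /g; apply: eq_bigr => i _; rewrite mxE.
exists n, e, (fun i x => h x 0 i); split=> [i r x y|x].
  by rewrite linearP !mxE.
by rewrite -[LHS]hK.
Qed.

Lemma nakayama (R : comPzRingType) (M : lmodType R) (I : R -> Prop)
    (n : nat) (e : 'I_n -> M) :
  I 0 -> (forall a b, I a -> I b -> I (a + b)) ->
  (forall r a, I a -> I (r * a)) ->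
  (forall x, exists c : 'I_n -> R,
    (forall i, I (c i)) /\ x = \sum_(i < n) c i *: e i) ->
  exists r, I (1 - r) /\ forall x : M, r *: x = 0.
Proof.
move=> I0 ID IM genI.
(* Generators are eliminated from the last one down: after [k] rounds [r] maps [M] into the span of
   the first [n - k]. *)
suff H k : (k <= n)%N -> exists r, I (1 - r) /\ forall x : M,
    exists d : 'I_n -> R, r *: x = \sum_(i < n | (i < n - k)%N) d i *: e i.
  have [r [Ir rP]] := H n (leqnn n); exists r; split=> // x.
  by have [d ->] := rP x; rewrite big_pred0 // => i; rewrite subnn.
elim: k => [|k IHk] lekn.
  exists 1; rewrite subrr; split=> // x.
  have [c [_ ->]] := genI x; exists c; rewrite scale1r.
  by apply: eq_bigl => i; rewrite subn0 ltn_ord.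
have [r [Ir rP]] := IHk (ltnW lekn).
have ltjn : (n - k.+1 < n)%N by rewrite ltn_subrL (leq_trans _ lekn).
pose j := Ordinal ltjn.
have splitj (F : 'I_n -> M) : \sum_(i < n | (i < n - k)%N) F i =
    F j + \sum_(i < n | (i < n - k.+1)%N) F i.
  rewrite (bigD1 j) /=; last by rewrite subnS prednK ?subn_gt0.
  congr (_ + _); apply: eq_bigl => i; rewrite subnS -val_eqE /= subnS.
  case: (n - k)%N (subn_gt0 k n) => [|m] /=; first by rewrite lekn.
  by move=> _; rewrite ltnS [RHS]ltn_neqAle andbC.
(* Expand [e j] with coefficients in [I], then push [r] onto each generator. *)
have [c [Ic rej]] : exists c : 'I_n -> R, (forall i, I (c i)) /\
    r *: e j = \sum_(i < n | (i < n - k)%N) c i *: e i.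
  have [a [Ia aP]] := genI (e j).
  have [d dP] := fin_all_exists (fun i => rP (e i)).
  exists (fun i => \sum_(l < n) d l i * a l); split=> [i|].
    by elim/big_ind: _ => // l _; apply: IM.
  rewrite {1}aP scaler_sumr.
  under eq_bigr => l _ do rewrite scalerA mulrC -scalerA dP scaler_sumr.
  rewrite exchange_big /=; apply: eq_bigr => i _; rewrite scaler_suml.
  by apply: eq_bigr => l _; rewrite scalerA mulrC.
(* The factor [r] brings [x] into the current span; then [r - c j] sends [e j] into the span of the
   earlier generators. *)
exists ((r - c j) * r); split.
  have -> : 1 - (r - c j) * r = (1 - r) + r * (1 - r) + r * c j.
    rewrite mulrBl mulrBr mulr1 opprB [c j * r]mulrC.
    by rewrite addrA [1 - r + _]addrA subrK addrAC.
  by apply: (ID _ _ (ID _ _ Ir (IM _ _ Ir)) (IM _ _ (Ic j))).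
move=> x; have [d dP] := rP x.
exists (fun i => d j * c i + (r - c j) * d i).
rewrite -scalerA dP splitj scalerDr scalerA [_ * d j]mulrC -scalerA.
rewrite scalerBl rej splitj [c j *: e j + _]addrC addrK !scaler_sumr.
rewrite -big_split /=.
by apply: eq_bigr => i _; rewrite scalerDl !scalerA.
Qed.

Lemma algebra_unit_splits (R : comPzRingType) (A : algType R) :
  finitely_generated (A : lmodType R) -> projective (A : lmodType R) ->
  faithful (A : lmodType R) ->
  exists t : A -> R,
    (forall r x y, t (r *: x + y) = r * t x + t y) /\ t 1 = 1.
Proof.
move=> fgA projA faithA.
have [n [e [f [f_lin fP]]]] := dual_basis fgA projA.
pose I a := exists t : A -> R,
  (forall r x y, t (r *: x + y) = r * t x + t y) /\ t 1 = a.
have I0 : I 0 by exists (fun=> 0); split=> // r _ _; rewrite mulr0 addr0.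
have ID a b : I a -> I b -> I (a + b).
  move=> [s [sl <-]] [t [tl <-]]; exists (fun x => s x + t x); split=> // r x y.
  by rewrite sl tl mulrDr addrACA.
have IM r a : I a -> I (r * a).
  move=> [s [sl <-]]; exists (fun x => r * s x); split=> // q x y.
  by rewrite sl mulrDr mulrCA.
have [|r [Ir /faithA r0]] := @nakayama R A I n e I0 ID IM.
  (* Write [x] as [1 * x] and expand [1], then each [e i * x], in the dual basis; every coefficient
     is a combination of the [f i 1]. *)
  move=> x; exists (fun k => \sum_(i < n) f k (e i * x) * f i 1); split=> [k|].
    elim/big_ind: _ => // i _; apply: IM.
    by exists (f i); split=> // r y z; apply: f_lin.
  rewrite -[LHS]mul1r {1}(fP 1) mulr_suml.
  under eq_bigr => i _ do rewrite -scalerAl (fP (e i * x)) scaler_sumr.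
  rewrite exchange_big /=; apply: eq_bigr => k _; rewrite scaler_suml.
  by apply: eq_bigr => i _; rewrite scalerA mulrC.
by move: Ir; rewrite r0 subr0.
Qed.

Lemma azumaya_separable (R : comPzRingType) (A : algType R) : azumaya A ->
  exists s : seq (A * A), \sum_(ab <- s) ab.1 * ab.2 = 1 /\
    forall x : A, tensor_eq (M := A) (N := A)
      [seq (x * ab.1, ab.2) | ab <- s] [seq (ab.1, ab.2 * x) | ab <- s].
Proof.
move=> [fgA projA faithA env_inj env_surj].
have [t [t_lin t1]] := algebra_unit_splits fgA projA faithA.
pose g (x : A) : A := (t x)%:A.
have g_lin : linear g by move=> r x y; rewrite /g t_lin scalerDl scalerA.
pose gL := GRing.isLinear.Build _ _ _ _ g g_lin.
pose G : {linear A -> A} := HB.pack g gL.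
have [s sG] := env_surj G; exists s; split.
  have := sG 1; rewrite /= /g t1 scale1r => <-.
  by apply: eq_bigr => ab _; rewrite mulr1.
(* By injectivity it suffices to compare actions on [y]: [x * g y] and [g y * x] agree as [g y] is a
   scalar. *)
move=> x; apply: env_inj => y; rewrite /enveloping_action !big_map /=.
transitivity (x * enveloping_action s y).
  by rewrite mulr_sumr; apply: eq_bigr => ab _; rewrite !mulrA.
transitivity (enveloping_action s y * x).
  by rewrite sG /= /g -scalerAl -scalerAr mul1r mulr1.
by rewrite mulr_suml; apply: eq_bigr => ab _; rewrite !mulrA.
Qed.

(** Universal property of the tensor product, by induction on the generating relations. *)
Lemma balanced_tensor_eq (R : comPzRingType) (M N : lmodType R) (Q : zmodType)
    (B : M -> N -> Q) :
  (forall x x' y, B (x + x') y = B x y + B x' y) ->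
  (forall x y y', B x (y + y') = B x y + B x y') ->
  (forall r x y, B (r *: x) y = B x (r *: y)) ->
  forall s t, tensor_eq s t ->
    \sum_(xy <- s) B xy.1 xy.2 = \sum_(xy <- t) B xy.1 xy.2.
Proof.
move=> BDl BDr BZ s t; elim=> {s t}.
- by [].
- by move=> s t _ ->.
- by move=> s t u _ -> _ ->.
- by move=> s s' t t' _ IH1 _ IH2; rewrite !big_cat /= IH1 IH2.
- by move=> s t; rewrite !big_cat /= addrC.
- move=> y; rewrite big_seq1 big_nil /=.
  by apply: (@addIr _ (B 0 y)); rewrite -BDl !add0r.
- by move=> x x' y; rewrite !big_cons !big_nil !addr0 /= BDl.
- by move=> x y y'; rewrite !big_cons !big_nil !addr0 /= BDr.
- by move=> r x y; rewrite !big_seq1 /= BZ.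
Qed.

Lemma differential_structure_exists (R : comPzRingType) (D_R : R -> R)
    (M : lmodType R) :
  is_derivation D_R -> finitely_generated M -> projective M ->
  exists D : M -> M, is_differential_structure D_R D.
Proof.
move=> [DD DM] fgM projM.
have [n [e [f [f_lin fP]]]] := dual_basis fgM projM.
(* Differentiate the coordinates and treat the [e i] as constants. *)
exists (fun x => \sum_(i < n) D_R (f i x) *: e i); split=> [x y|r x].
  rewrite -big_split /=; apply: eq_bigr => i _.
  by rewrite -[x in LHS]scale1r f_lin mul1r DD scalerDl.
rewrite {2}(fP x) !scaler_sumr -big_split /=; apply: eq_bigr => i _.
have f0 : f i 0 = 0.
  by apply: (@addIr _ (f i 0)); rewrite -{1}[f i 0]mul1r -f_lin scaler0 !add0r.
by rewrite -[r *: x]addr0 f_lin f0 addr0 DM scalerDl !scalerA.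
Qed.

Theorem corollary2 (R : comPzRingType) (D_R : R -> R)
    (A : algType R) (D_A : A -> A) (P : lmodType A)
    (derR : is_derivation D_R)
    (azuA : azumaya A)
    (derA : is_derivation D_A)
    (extA : extends_derivation D_R D_A)
    (fgP : finitely_generated (restrict_scalars P : lmodType R))
    (projP : projective (restrict_scalars P : lmodType R)) :
  exists D_P : P -> P, is_differential_structure D_A D_P.
Proof.
have [D0 [D0D D0Z]] : exists D0 : P -> P,
    (forall p q, D0 (p + q) = D0 p + D0 q) /\
    (forall (r : R) p, D0 ((r%:A : A) *: p) =
       ((D_R r)%:A : A) *: p + (r%:A : A) *: D0 p).
  exact: (differential_structure_exists derR fgP projP).
have [DD DM] := derA.
have [s [s1 sC]] := azumaya_separable azuA.
have scA (r : R) (a : A) : r%:A * a = a * r%:A.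
  by rewrite -scalerAl -scalerAr mul1r mulr1.
pose phi (a : A) (p : P) : P := D0 (a *: p) - (D_A a *: p + a *: D0 p).
have phiE a p : D0 (a *: p) = phi a p + (D_A a *: p + a *: D0 p).
  by rewrite subrK.
have phiDl a b p : phi (a + b) p = phi a p + phi b p.
  by rewrite /phi DD !scalerDl D0D [D_A a *: p + _ + _]addrACA opprD addrACA.
have phiDr a p q : phi a (p + q) = phi a p + phi a q.
  rewrite /phi scalerDr !D0D !scalerDr.
  by rewrite [D_A a *: p + _ + _]addrACA opprD addrACA.
have phi_scal (r : R) p : phi r%:A p = 0 by rewrite /phi extA D0Z subrr.
clearbody phi.
(* Expand [D0 ((a * b) *: p)] in two ways. *)
have phiM a b p : phi (a * b) p = phi a (b *: p) + a *: phi b p.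
  apply: (@addIr _ (D_A (a * b) *: p + (a * b) *: D0 p)).
  rewrite -phiE DM scalerDl -!scalerA !phiE !scalerDr -!addrA.
  by rewrite [D_A a *: _ + (a *: phi _ _ + _)]addrCA.
have phiZl (r : R) a p : phi (r *: a) p = phi a ((r%:A : A) *: p).
  by rewrite -(mulr_algl r a) scA phiM phi_scal scaler0 addr0.
pose u p : P := \sum_(ab <- s) phi ab.1 (ab.2 *: p).
(* Apply the balanced map [B] to the relation [sC a], expand [phi (a * ab.1)] by [phiM], and
   collapse the first terms with [s1]. *)
have uZ a p : u (a *: p) = phi a p + a *: u p.
  pose B (x y : A) := phi x (y *: p).
  have := @balanced_tensor_eq R A A P B _ _ _ _ _ (sC a).
  rewrite !big_map /= /B => eqB.
  transitivity (\sum_(ab <- s) phi (a * ab.1) (ab.2 *: p)).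
    rewrite eqB /u => [|x x' y|x y y'|r x y].
    - by apply: eq_bigr => ab _; rewrite scalerA.
    - by rewrite phiDl.
    - by rewrite scalerDl phiDr.
    - by rewrite phiZl scalerA mulr_algl.
  have phi_sum : phi a p = \sum_(ab <- s) phi a ((ab.1 * ab.2) *: p).
    rewrite -{1}[p]scale1r -s1 scaler_suml.
    apply: (big_morph (phi a) (phiDr a)).
    by apply: (@addIr _ (phi a 0)); rewrite -phiDr !add0r.
  rewrite phi_sum scaler_sumr -big_split /=; apply: eq_bigr => ab _.
  by rewrite phiM scalerA.
exists (fun p => D0 p - u p); split=> [p q|a p].
  have uD : u (p + q) = u p + u q.
    by rewrite /u -big_split; apply: eq_bigr => ab _; rewrite scalerDr phiDr.
  by rewrite D0D uD opprD addrACA.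
by rewrite phiE uZ opprD addrACA subrr add0r scalerBr addrA.
Qed.
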